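(* Let $(X,\mathcal{B},\mu)$ be a probability Lebesgue space, let $d$ be a metric on $X$ such that the support $\operatorname{supp}\mu$ is not reduced to a single point, and let $T:X\to X$ be an endomorphism of $(X,\mathcal{B},\mu)$. Assume that $T$ is weakly mixing. Then $T$ is symmetrically sensitive and moreover $$\Delta(T)=\operatorname{diam}(\operatorname{supp}\mu).$$
   Context: An endomorphism $T$ of $(X,\mathcal{B},\mu)$ is a measurable map $T:X\to X$ preserving $\mu$, i.e. $\mu(T^{-1}A)=\mu(A)$ for all $A\in\mathcal{B}$. $\mu^{\otimes 2}=\mu\otimes\mu$ is the product measure on $X^2$ (understood as completed), and $\operatorname{supp}\mu$ is the topological support of $\mu$ for the metric $d$: the set of points all of whose open $d$-balls have positive measure. The metric is compatible with the measure structure: $\mathcal{B}$ contains the Borel sets of $(X,d)$ and $\mu(\operatorname{supp}\mu)=1$. A number $\delta>0$ is a sensitivity constant for $T$ if for $\mu^{\otimes 2}$-a.e. $(x,y)\in X^2$ one can find $n\ge 0$ with $d(T^n x,T^n y)\ge\delta$. $T$ is symmetrically sensitive if there exists a sensitivity constant $\delta>0$ for $T$. One sets $\Delta(T)=\sup\{\delta : \delta \text{ is a sensitivity constant for } T\}\in(0,\infty]$. $\operatorname{diam}(A)\in[0,\infty]$ is the $d$-diameter of $A\subset X$. *)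

(* Defs.v *)
From HB Require Import structures.
From mathcomp Require Import all_boot all_order all_algebra.
From mathcomp Require Import all_classical all_reals all_analysis.

Set Implicit Arguments.
Unset Strict Implicit.
Unset Printing Implicit Defensive.
Import Order.TTheory GRing.Theory Num.Theory.
Import numFieldNormedType.Exports.

Local Open Scope classical_set_scope.
Local Open Scope ring_scope.

(* A set carrying both a sigma-algebra and a metric, with no relation between
   the two imposed by the structure. *)
#[short(type="measurableMetricType")]
HB.structure Definition MeasurableMetric (d : measure_display) (R : realType) :=
  {X of Measurable d X & Metric R X}.

Section isomorphism_mod0.
Local Open Scope ereal_scope.

Definition iso_mod0 (R : realType) d1 d2 (X : measurableType d1)
    (Y : measurableType d2) (mu : set X -> \bar R) (nu : set Y -> \bar R) :=
  exists (X0 : set X) (Y0 : set Y) (f : X -> Y),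
    [/\ measurable X0 /\ mu (~` X0) = 0,
        measurable Y0 /\ nu (~` Y0) = 0,
        set_bij X0 Y0 f,
        (forall B, B `<=` Y0 -> (measurable B <-> measurable (X0 `&` f @^-1` B)))
      & (forall B, B `<=` Y0 -> measurable B -> mu (X0 `&` f @^-1` B) = nu B)].

(* The real line with the sigma-algebra of Lebesgue measurable sets. *)
Definition lebesgue_line (R : realType) :=
  caratheodory_type (R := R) (T := ocitv_type R) (wlength idfun)^*%mu.

(* Lebesgue measure on [0, c] plus a mass w n at the point - (n + 1), which lies
   off [0, c]: up to null sets, the disjoint union of an interval and of the
   countable set of atoms {- (n + 1) | 0 < w n}. *)
Definition interval_atoms (R : realType) (c : R) (w : nat -> R)
    (A : set (lebesgue_line R)) : \bar R :=
  completed_lebesgue_measure (A `&` [set` `[0%R, c]%R]) +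
  \sum_(0 <= n <oo) (w n)%:E * \d_((- n.+1%:R)%R : lebesgue_line R) A.

(* Lebesgue (Lebesgue-Rokhlin, standard) probability space. The total mass of
   the model is 1 because it is isomorphic mod 0 to a probability. *)
Definition lebesgue_space (R : realType) d (X : measurableType d)
    (mu : probability X R) :=
  measure_is_complete mu /\
  exists (c : R) (w : nat -> R),
    [/\ (0 <= c)%R, (forall n, (0 <= w n)%R) & iso_mod0 mu (interval_atoms c w)].

End isomorphism_mod0.

Section dynamics.
Context (R : realType) (d : measure_display) (X : measurableType d).
Variable mu : probability X R.

Definition endomorphism (T : X -> X) :=
  measurable_fun setT T /\
  forall A, measurable A -> mu (T @^-1` A) = mu A.

(* The defining condition of weak mixing by Cesaro means of correlations; the term
   n = 0 of the sequence is 0. *)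
Definition weakly_mixing (T : X -> X) :=
  forall A B, measurable A -> measurable B ->
    (fun n : nat => n%:R^-1 * \sum_(k < n)
       `|fine (mu (iter k T @^-1` A `&` B)) - fine (mu A) * fine (mu B)|)
    @ \oo --> (0 : R).

End dynamics.

Section sensitivity.
Context (R : realType) (d : measure_display) (X : measurableMetricType d R).
Local Open Scope ereal_scope.

(* As a supremum in \bar R this is -oo on set0 and lies in [0, +oo] otherwise. *)
Definition diam (A : set X) : \bar R :=
  ereal_sup [set r | exists x y, [/\ A x, A y & r = (mdist x y)%:E]].

Variable mu : probability X R.

Definition supp : set X := [set x | forall r : R, (0 < r)%R -> 0 < mu (ball x r)].

Definition metric_compatible :=
  (forall U : set X, open U -> measurable U) /\ mu supp = 1.

(* The filter of sets that are conull for mu \x mu contains every set whose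
   complement lies in a measurable null set, so it is the one of the completed
   product. *)
Definition sensitivity_constant (T : X -> X) (delta : R) :=
  (0 < delta)%R /\
  {ae (mu \x mu), forall z : X * X,
     exists n, (delta <= mdist (iter n T z.1) (iter n T z.2))%R}.

Definition symmetrically_sensitive (T : X -> X) :=
  exists delta : R, sensitivity_constant T delta.

Definition Delta (T : X -> X) : \bar R :=
  ereal_sup [set delta%:E | delta in sensitivity_constant T].

End sensitivity.

(* Main.v *)
(** Let A and B be small balls around two points of the support.  Weak mixing
    makes the events (T x T)^-k (A x B) Cesaro-asymptotically independent of
    every rectangle, hence of every measurable set M.  Taking for M the set of
    pairs that never visit A x B, which is disjoint from all these events,
    forces M to be null; so almost every pair gets almost as far apart as the
    centres of A and B.  Conversely, almost every pair has both orbits inside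
    the support, so no sensitivity constant exceeds the diameter. *)
Require Import Defs.
From mathcomp Require Import all_boot all_order all_algebra.
From mathcomp Require Import all_classical all_reals all_analysis.
From mathcomp Require Import ring lra.

Local Open Scope classical_set_scope.

(** * Sequences whose absolute values have Cesaro means tending to 0 *)

Section cesaro.
Set Implicit Arguments.
Unset Strict Implicit.
Import Order.TTheory GRing.Theory Num.Theory.
Import numFieldNormedType.Exports.
Local Open Scope ring_scope.
Context {R : realType}.
Implicit Types u v w : nat -> R.

(** This has the shape of the means in [weakly_mixing]; its value at [n = 0] is 0, whatever [u]
    is. *)
Definition cesaro_norm u (n : nat) : R := n%:R^-1 * \sum_(k < n) `|u k|.

Definition cesaro_null u := cesaro_norm u @ \oo --> (0 : R).

Lemma cesaro_norm_ge0 u n : 0 <= cesaro_norm u n.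
Proof. by rewrite mulr_ge0 ?invr_ge0 ?sumr_ge0. Qed.

Lemma cesaro_norm_le u v w n : (forall k, `|u k| <= `|v k| + `|w k|) ->
  cesaro_norm u n <= cesaro_norm v n + cesaro_norm w n.
Proof.
move=> uvw; rewrite -mulrDr -big_split/= ler_wpM2l ?invr_ge0//.
exact: ler_sum.
Qed.

Lemma cesaro_norm_cst c n : (0 < n)%N -> cesaro_norm (fun=> c) n = `|c|.
Proof.
move=> n0; rewrite /cesaro_norm sumr_const card_ord -(mulr_natl `|c|) mulrA.
by rewrite mulVf ?mul1r// pnatr_eq0 -lt0n.
Qed.

Lemma cesaro_null_le u v w : (forall k, `|u k| <= `|v k| + `|w k|) ->
  cesaro_null v -> cesaro_null w -> cesaro_null u.
Proof.
move=> uvw v0 w0.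
apply: (@squeeze_cvgr _ _ _ _ (cst 0) (cesaro_norm v \+ cesaro_norm w)).
- by apply: nearW => n; rewrite cesaro_norm_ge0 cesaro_norm_le.
- exact: cvg_cst.
- by rewrite -[X in _ --> X]addr0; exact: cvgD.
Qed.

Lemma cesaro_null0 : cesaro_null (fun=> 0 : R).
Proof.
rewrite /cesaro_null (_ : cesaro_norm _ = cst 0); first exact: cvg_cst.
by apply/funext => n; rewrite /cesaro_norm big1 ?mulr0// => k; rewrite normr0.
Qed.

(** A constant error [e] has Cesaro mean [e], so being Cesaro-null is closed under approximation
    uniform in [k]; [v] may depend on [e]. *)
Lemma cesaro_null_approx u :
  (forall e : R, 0 < e ->
    exists2 v, cesaro_null v & forall k, `|u k| <= `|v k| + e) ->
  cesaro_null u.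
Proof.
move=> uv; apply/cvgr0Pnorm_le => e e0.
have [|v v0 uve] := uv (e / 2); first by rewrite divr_gt0.
move/cvgr0_norm_le: v0 => /(_ (e / 2)) v0.
near=> n; rewrite ger0_norm ?cesaro_norm_ge0//.
have e2 : `|e / 2| = e / 2 by rewrite ger0_norm// divr_ge0// ltW.
have uve' k : `|u k| <= `|v k| + `|(e / 2 : R)| by rewrite e2.
apply: le_trans (cesaro_norm_le n uve') _.
rewrite cesaro_norm_cst; last by near: n; exact: nbhs_infty_gt.
rewrite e2 [leRHS]splitr lerD2r -[leLHS]ger0_norm ?cesaro_norm_ge0//.
by near: n; apply: v0; rewrite divr_gt0.
Unshelve. all: by end_near. Qed.

Lemma cesaro_null_cst c : cesaro_null (fun=> c) -> c = 0.
Proof.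
move=> c0; apply/normr0_eq0.
apply: (@cvg_unique _ _ (cesaro_norm (fun=> c) @ \oo) _ `|c| 0) => //.
apply: cvg_near_cst; near=> n; apply: cesaro_norm_cst.
by near: n; exact: nbhs_infty_gt.
Unshelve. all: by end_near. Qed.

End cesaro.

(** * Correlations of events and asymptotic independence in the Cesaro sense *)

Section cesaro_independence.
Set Implicit Arguments.
Unset Strict Implicit.
Import Order.TTheory GRing.Theory Num.Theory.
Import numFieldNormedType.Exports.
Local Open Scope ring_scope.
Context {R : realType} {d : measure_display} {Y : measurableType d}.
Variable P : probability Y R.
Implicit Types A B M : set Y.

Definition prob M : R := fine (P M).

Lemma probE M : measurable M -> P M = (prob M)%:E.
Proof. by move=> mM; rewrite fineK// fin_num_measure. Qed.

Lemma prob_ge0 M : 0 <= prob M.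
Proof. exact/fine_ge0/measure_ge0. Qed.

Lemma prob_le1 M : measurable M -> prob M <= 1.
Proof. by move=> mM; rewrite -lee_fin -probE// probability_le1. Qed.

Lemma prob_le A B : measurable A -> measurable B -> A `<=` B ->
  prob A <= prob B.
Proof. by move=> mA mB AB; rewrite -lee_fin -!probE// le_measure// inE. Qed.

Lemma probD A B : measurable A -> measurable B -> B `<=` A ->
  prob (A `\` B) = prob A - prob B.
Proof.
move=> mA mB BA; apply: EFin_inj; rewrite EFinB -!probE//; last first.
  exact: measurableD.
rewrite measureD//; last by rewrite ltey_eq fin_num_measure.
by rewrite setIidr.
Qed.

(** The covariance of the two indicator functions. *)
Definition correlation A B : R := prob (A `&` B) - prob A * prob B.

Lemma correlationT A : correlation A setT = 0.
Proof.
by rewrite /correlation setIT /prob probability_setT mulr1 subrr.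
Qed.

Lemma correlationDr A M M' : measurable A -> measurable M -> measurable M' ->
  M' `<=` M ->
  correlation A (M `\` M') = correlation A M - correlation A M'.
Proof.
move=> mA mM mM' M'M; rewrite /correlation.
have -> : A `&` (M `\` M') = (A `&` M) `\` (A `&` M').
  apply/seteqP; split=> x /=; first by move=> [Ax [Mx nM']]; split => // -[].
  by move=> [[Ax Mx] nM']; do 2 split => //; move=> M'x; exact: nM'.
rewrite !probD//; [|exact: measurableI|exact: measurableI|exact: setIS].
ring.
Qed.

(** Both terms of the correlation lie between 0 and [prob M]. The bound does not involve [A], which
    gives uniformity along a sequence of events. *)
Lemma norm_correlation_le A M : measurable A -> measurable M ->
  `|correlation A M| <= prob M.
Proof.
move=> mA mM; rewrite ler_norml /correlation; apply/andP; split.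
  rewrite lerBrDr addrC; apply: le_trans (prob_ge0 _).
  by rewrite subr_le0 ler_piMl ?prob_ge0 ?prob_le1.
rewrite lerBlDr ler_wpDr ?mulr_ge0 ?prob_ge0//.
by apply: prob_le => //; exact: measurableI.
Qed.

(* Cesaro-asymptotic independence of the events E k from M passes from a
   generating pi-system to the sigma-algebra, because both members of the
   correlation are continuous in M uniformly in k. *)
Lemma cesaro_null_correlation (G : set (set Y)) (E : nat -> set Y) :
    @measurable d Y = <<s G >> -> setI_closed G ->
    (forall k, measurable (E k)) ->
    (forall M, G M -> cesaro_null (fun k => correlation (E k) M)) ->
  forall M, measurable M -> cesaro_null (fun k => correlation (E k) M).
Proof.
move=> mG GI mE GE.
pose H := [set M | measurable M /\
  cesaro_null (fun k => correlation (E k) M)].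
(* Dynkin's theorem: a lambda-system containing the pi-system [G] contains the sigma-algebra it
   generates. *)
suff lH : lambda_system setT H.
  have GH : G `<=` H.
    by move=> M GM; split; [rewrite mG; exact: sub_sigma_algebra|exact: GE].
  move=> M; rewrite mG.
  by move/(lambda_system_subset GI lH GH (fun _ _ _ _ => I))=> [].
split=> //.
- split=> //; rewrite (_ : (fun _ => _) = fun=> 0); first exact: cesaro_null0.
  by apply/funext => k; rewrite correlationT.
- move=> M M' M'M [mM M0] [mM' M'0]; split; first exact: measurableD.
  by apply: cesaro_null_le M0 M'0 => k; rewrite correlationDr// ler_normB.
- move=> F ndF HF.
  have mF n : measurable (F n) by have [] := HF n.
  have mUF : measurable (\bigcup_n F n) by exact: bigcupT_measurable.
  split=> //; apply: cesaro_null_approx => e e0.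
  (* Continuity of [P] from below gives one [n] that serves every [k]. *)
  have [n Fn] : exists n, prob (\bigcup_n F n `\` F n) <= e.
    have cF : prob (F n) @[n --> \oo] --> prob (\bigcup_n F n).
      apply: fine_cvg; rewrite -/(prob _) -probE//.
      exact: nondecreasing_cvg_mu.
    move/cvgrPdist_le: cF => /(_ e e0)[n _ /(_ n (leqnn n))/= Fn].
    exists n; rewrite probD//; last exact: bigcup_sup.
    by rewrite (le_trans (ler_norm _)).
  exists (fun k => correlation (E k) (F n)); first by have [] := HF n.
  move=> k; rewrite -lerBlDl; apply: le_trans Fn.
  apply: le_trans (norm_correlation_le (mE k) (measurableD mUF (mF n))).
  rewrite correlationDr//; last exact: bigcup_sup.
  exact: lerB_dist.
Qed.

(** Disjointness turns every correlation into the constant [- (p * prob N)], and a constant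
    Cesaro-null sequence vanishes; then [0 < p] leaves [prob N = 0]. *)
Lemma null_disjoint_cesaro_null (p : R) (E : nat -> set Y) (N : set Y) :
    0 < p -> (forall k, prob (E k) = p) -> (forall k, E k `&` N = set0) ->
    measurable N -> cesaro_null (fun k => correlation (E k) N) ->
  P N = 0%E.
Proof.
move=> p0 Ep EN mN; rewrite (_ : (fun _ => _) = fun=> - (p * prob N)).
  move/cesaro_null_cst/eqP; rewrite oppr_eq0 mulf_eq0 gt_eqF//= => /eqP N0.
  by rewrite probE// N0.
by apply/funext => k; rewrite /correlation EN Ep /prob measure0 sub0r.
Qed.

End cesaro_independence.

(** * Orbits of pairs of points under the product map *)

Section weak_mixing_square.
Set Implicit Arguments.
Unset Strict Implicit.
Import Order.TTheory GRing.Theory Num.Theory.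
Import numFieldNormedType.Exports.
Local Open Scope ring_scope.
Context {R : realType} {d : measure_display} {X : measurableType d}.
Variables (mu : probability X R) (T : X -> X).
Hypotheses (hT : endomorphism mu T).
Implicit Types A B C D : set X.

Lemma measurable_iter_preimage A k : measurable A ->
  measurable (iter k T @^-1` A).
Proof.
move=> mA; elim: k => //= k IH.
have [mT _] := hT; rewrite (_ : _ @^-1` _ = T @^-1` (iter k T @^-1` A)).
  by rewrite -[X in measurable X]setTI; exact: mT.
by apply/seteqP; split=> x /=; rewrite -iterS iterSr.
Qed.

Lemma measure_iter_preimage A k : measurable A ->
  mu (iter k T @^-1` A) = mu A.
Proof.
move=> mA; elim: k => //= k IH.
have [_ hmu] := hT; rewrite (_ : _ @^-1` _ = T @^-1` (iter k T @^-1` A)).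
  by rewrite hmu ?IH//; exact: measurable_iter_preimage.
by apply/seteqP; split=> x /=; rewrite -iterS iterSr.
Qed.

(** The preimage of [A × B] under the [k]-th iterate of [T × T]. *)
Let E A B k := (iter k T @^-1` A) `*` (iter k T @^-1` B).

Lemma prob_setX A B : measurable A -> measurable B ->
  prob (mu \x mu)%E (A `*` B) = prob mu A * prob mu B.
Proof.
move=> mA mB; rewrite -[LHS]/(fine ((mu \x mu)%E (A `*` B))).
by rewrite product_measure1E// fineM// fin_num_measure.
Qed.

Lemma correlation_setX A B C D :
    measurable A -> measurable B -> measurable C -> measurable D ->
  `|correlation (mu \x mu)%E (A `*` B) (C `*` D)| <=
  `|correlation mu A C| + `|correlation mu B D|.
Proof.
move=> mA mB mC mD; rewrite /correlation -setXI.
rewrite !prob_setX//; [|exact: measurableI|exact: measurableI].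
set a := prob mu (A `&` C); set b := prob mu (B `&` D).
rewrite mulrACA.
set a' := prob mu A * _; set b' := prob mu B * _.
rewrite (_ : _ - _ = (a - a') * b + a' * (b - b')); last first.
  by rewrite mulrBl mulrBr addrA subrK.
apply: le_trans (ler_normD _ _) _; rewrite !normrM lerD//.
  rewrite ler_piMr// ger0_norm ?prob_ge0//.
  by apply: prob_le1; exact: measurableI.
rewrite ler_piMl// -normrM ger0_norm ?mulr_ge0 ?prob_ge0//.
by rewrite mulr_ile1 ?prob_ge0 ?prob_le1.
Qed.

Lemma weakly_mixing_simultaneous_visit A B : weakly_mixing mu T ->
    measurable A -> measurable B -> (0 < mu A)%E -> (0 < mu B)%E ->
  {ae (mu \x mu)%E, forall z : X * X,
    exists n, A (iter n T z.1) /\ B (iter n T z.2)}.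
Proof.
move=> wm mA mB A0 B0.
have mE k : measurable (E A B k).
  by apply: measurableX; exact: measurable_iter_preimage.
(* The pairs that never visit [A × B]: disjoint from each [E A B k], whose measure is the same
   positive number for all [k]. *)
pose N := ~` \bigcup_k E A B k.
have mN : measurable N by apply: measurableC; exact: bigcupT_measurable.
exists N; split => //; last first.
  by move=> z /= nz [k _ [Az Bz]]; apply: nz; exists k.
apply: (@null_disjoint_cesaro_null _ _ _ _ (prob mu A * prob mu B) (E A B)) => //.
- by rewrite mulr_gt0// -lte_fin -probE.
- move=> k; rewrite prob_setX; [|exact: measurable_iter_preimage..].
  by rewrite /prob !measure_iter_preimage.
- move=> k; apply/seteqP; split=> // z [Ez]; apply; exists k => //.
(* Measurable rectangles form a generating pi-system of the product, so only they remain to be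
   tested. *)
apply: cesaro_null_correlation (measurable_prod_measurableType X X) _ _ _ _ mN.
- move=> _ _ [A1 mA1 [A2 mA2 <-]] [B1 mB1 [B2 mB2 <-]].
  exists (A1 `&` B1); first exact: measurableI.
  exists (A2 `&` B2); first exact: measurableI.
  by rewrite setXI.
- exact: mE.
move=> _ [C mC [D mD <-]].
(* Invariance replaces the measure of each preimage of [F] by that of [F], giving the very sequence
   of [weakly_mixing]. *)
have corrE F G : measurable F -> measurable G ->
    cesaro_null (fun k => correlation mu (iter k T @^-1` F) G).
  move=> mF mG; rewrite /cesaro_null (_ : cesaro_norm _ = fun n : nat =>
      n%:R^-1 * \sum_(k < n) `|fine (mu (iter k T @^-1` F `&` G)) -
                              fine (mu F) * fine (mu G)|); first exact: wm.
  apply/funext => n; congr (_ * _).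
  apply: eq_bigr => k _; rewrite /correlation /prob.
  by rewrite measure_iter_preimage.
apply: cesaro_null_le (corrE A C mA mC) (corrE B D mB mD) => k.
by apply: correlation_setX => //; exact: measurable_iter_preimage.
Qed.

(** By invariance all preimages of [A] are conull, hence so is their countable intersection [G].
    Then [G × G] has measure 1 and cannot lie in a null set containing all failures of [Q]. *)
Lemma ae_orbits_in_conull A (Q : X * X -> Prop) :
    measurable A -> mu A = 1%E -> {ae (mu \x mu)%E, forall z, Q z} ->
  exists z, [/\ Q z, forall n, A (iter n T z.1) & forall n, A (iter n T z.2)].
Proof.
move=> mA A1 [N [mN N0 QN]].
pose G := \bigcap_n (iter n T @^-1` A).
have mG : measurable G.
  by apply: bigcapT_measurable => n; exact: measurable_iter_preimage.
have G1 : mu G = 1%E.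
  have : {ae mu, forall x, forall n, A (iter n T x)}.
    apply: ae_foralln => n; exists (~` (iter n T @^-1` A)); split => //.
      by apply: measurableC; exact: measurable_iter_preimage.
    apply: (etrans (probability_setC mu (measurable_iter_preimage n mA))).
    by rewrite measure_iter_preimage// A1 subee.
  move=> nG; have : mu (~` G) = 0%E.
    apply/(negligibleP _ (measurableC mG)); apply: negligibleS nG => x /= nGx h.
    by apply: nGx => n _; exact: h.
  move=> nG0; rewrite -(setCK G) probability_setC; last exact: measurableC.
  by rewrite nG0 sube0.
apply: contrapT => noz.
have GN : G `*` G `<=` N.
  move=> z [G1z G2z]; apply: QN => Qz; apply: noz; exists z; split => // n.
    exact: G1z.
  exact: G2z.
have : ((mu \x mu) (G `*` G) <= (mu \x mu) N)%E.
  by apply: le_measure; rewrite ?inE//; exact: measurableX.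
rewrite (_ : (mu \x mu) (G `*` G) = mu G * mu G)%E; last first.
  exact: product_measure1E.
by rewrite G1 N0 mule1 lee_fin ler10.
Qed.

End weak_mixing_square.

(** * The support of the measure and bounds on sensitivity constants *)

Section support.
Set Implicit Arguments.
Unset Strict Implicit.
Import Order.TTheory GRing.Theory Num.Theory.
Import numFieldNormedType.Exports.
Local Open Scope ring_scope.

Lemma metric_ball_open (R : realType) (M : metricType R) (x : M) (r : R) :
  open (ball x r).
Proof.
rewrite openE => y; rewrite ballEmdist/= => xyr.
apply/nbhs_ballP; exists (r - mdist x y); first by rewrite /= subr_gt0.
move=> z; rewrite !ballEmdist/= => yz.
by rewrite (le_lt_trans (metric_triangle x y z))// addrC -ltrBrDr.
Qed.

Context {R : realType} {d : measure_display} {X : measurableMetricType d R}.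
Variable mu : probability X R.
Hypothesis hd : metric_compatible mu.

Lemma measurable_ball_compatible (x : X) (r : R) : measurable (ball x r).
Proof. by have [mO _] := hd; exact/mO/metric_ball_open. Qed.

(** If [ball x r] is null, so is each ball of radius [r / 2] centred in [ball x (r / 2)], being
    contained in it. Hence the complement of the support is open. *)
Lemma measurable_supp : measurable (supp mu).
Proof.
have [mO _] := hd; rewrite -[supp mu]setCK; apply/measurableC/mO.
rewrite openE => x /= /existsNP[r /not_implyP[r0 /negP]].
rewrite -leNgt => xr0; apply/nbhs_ballP; exists (r / 2).
  by rewrite /= divr_gt0.
move=> y xy /(_ (r / 2)); rewrite divr_gt0// => /(_ isT); apply/negP.
rewrite -leNgt; apply: le_trans xr0; apply: le_measure.
- by rewrite inE; exact: measurable_ball_compatible.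
- by rewrite inE; exact: measurable_ball_compatible.
- by move=> z yz; rewrite [r]splitr; exact: ball_triangle yz.
Qed.

Lemma supp_nontrivial : (forall x, supp mu <> [set x]) ->
  exists x y, [/\ supp mu x, supp mu y & 0 < mdist x y].
Proof.
move=> hsupp; have [_ s1] := hd.
have [s0|/set0P[x sx]] := eqVneq (supp mu) set0.
  by move: s1; rewrite s0 measure0 => /esym/eqP; rewrite onee_eq0.
exists x; apply: contrapT => hx; apply: (hsupp x); apply/seteqP.
split=> [y sy|_ -> //]; apply: contrapT => /eqP yx; apply: hx; exists y.
by split=> //; rewrite mdist_gt0 eq_sym.
Qed.

Variable T : X -> X.
Hypotheses (hT : endomorphism mu T).

Lemma sensitivity_constant_lt_supp (x y : X) (delta : R) :
    weakly_mixing mu T -> supp mu x -> supp mu y ->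
    0 < delta < mdist x y ->
  sensitivity_constant mu T delta.
Proof.
move=> wm sx sy /andP[delta0 dxy]; split => //.
(* Points within [r] of [x] and of [y] are more than [mdist x y - 2 * r = delta] apart. *)
pose r := (mdist x y - delta) / 2.
have r0 : 0 < r by rewrite divr_gt0// subr_gt0.
have := weakly_mixing_simultaneous_visit hT wm
  (measurable_ball_compatible x r) (measurable_ball_compatible y r)
  (sx _ r0) (sy _ r0).
apply: filterS => z [n []]; rewrite !ballEmdist/= => xz yz; exists n.
have := metric_triangle x (iter n T z.1) y.
have := metric_triangle (iter n T z.1) (iter n T z.2) y.
rewrite (metric_sym (iter n T z.2)); move: xz yz; rewrite /r; lra.
Qed.

Lemma sensitivity_constant_le_diam (delta : R) :
  sensitivity_constant mu T delta -> (delta%:E <= diam (supp mu))%E.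
Proof.
move=> [_ hdelta]; have [_ s1] := hd.
have [z [[n dn] z1 z2]] := ae_orbits_in_conull hT measurable_supp s1 hdelta.
apply: le_trans (_ : (mdist (iter n T z.1) (iter n T z.2))%:E <= _)%E.
  by rewrite lee_fin.
by apply: ereal_sup_ubound; exists (iter n T z.1), (iter n T z.2).
Qed.

End support.

(** * Symmetric sensitivity and the value of the supremum *)

Import Order.TTheory GRing.Theory Num.Theory.

Theorem theorem2p2 (R : realType) (d : measure_display)
    (X : measurableMetricType d R) (mu : probability X R) (T : X -> X)
    (hX : lebesgue_space mu)
    (hd : metric_compatible mu)
    (hsupp : forall x : X, supp mu <> [set x])
    (hT : endomorphism mu T)
    (hwm : weakly_mixing mu T) :
  symmetrically_sensitive mu T /\ Delta mu T = diam (supp mu).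
Proof.
have below x y delta :=
  @sensitivity_constant_lt_supp _ _ _ _ hd _ hT x y delta hwm.
have [x [y [sx sy xy0]]] := supp_nontrivial hd hsupp.
have sens : sensitivity_constant mu T (mdist x y / 2)%R.
  by apply: (below x y) => //; apply/andP; split; lra.
split; first by exists (mdist x y / 2)%R.
apply/eqP; rewrite eq_le; apply/andP; split.
  apply: ge_ereal_sup => _ [delta hdelta <-].
  exact: sensitivity_constant_le_diam hdelta.
(* Needed below when [mdist u v <= e], where [mdist u v - e] is not positive and so is no
   sensitivity constant. *)
have Delta_ge0 : (0 <= Delta mu T)%E.
  apply: le_trans (_ : (mdist x y / 2)%:E <= _)%E.
    by rewrite lee_fin; lra.
  by apply: ereal_sup_ubound; exists (mdist x y / 2)%R.
apply: ge_ereal_sup => _ [u [v [su sv ->]]].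
(* Only constants strictly below [mdist u v] are available, hence the loss of an arbitrary [e]. *)
apply/lee_addgt0Pr => e e0.
have [de0|de0] := leP (mdist u v) e.
  apply: le_trans (_ : e%:E <= _)%E; first by rewrite lee_fin.
  by rewrite leeDr.
rewrite -leeBlDr// -EFinB; apply: ereal_sup_ubound.
exists (mdist u v - e)%R => //; apply: (below u v) => //.
by apply/andP; split; lra.
Qed.
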